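(* Let $X=\{X(m,n)\}_{(m,n)\in\mathbb N^2}$ be a subproduct system with coisometries $\{U^X_{(i,j),(k,l)}\}$, and put $E=X(1,0)$, $F=X(0,1)$. Then $X$ is isomorphic to a subproduct system $Y=\{Y(m,n)\}_{(m,n)\in\mathbb N^2}$ with coisometries $\{U^Y_{(i,j),(k,l)}\}$ such that for all $(m,n)\neq(0,0)$ $$Y(m,n)\subset E^{\otimes m}\otimes F^{\otimes n},$$ and $$U^Y_{(i,j),(k,l)}=p_{(i+k,j+l)}W^u_{(i,j),(k,l)}\big|_{Y(i,j)\otimes Y(k,l)},$$ where $p_{(m,n)}\in B(E^{\otimes m}\otimes F^{\otimes n})$ is the orthogonal projection onto $Y(m,n)$, and $u$ can be chosen as any unitary operator from $F\otimes E$ to $E\otimes F$ that satisfies $p_{(1,1)}u=(U^X_{(1,0),(0,1)})^*U^X_{(0,1),(1,0)}$. Moreover, for all $(i,j),(k,l)\in\mathbb N^2$, $$p_{(i+k,j+l)}\le W^u_{(i,j),(k,l)}\,(p_{(i,j)}\otimes I_{E^{\otimes k}\otimes F^{\otimes l}})\,(W^u_{(i,j),(k,l)})^*,$$ $$p_{(i+k,j+l)}\le W^u_{(i,j),(k,l)}\,(I_{E^{\otimes i}\otimes F^{\otimes j}}\otimes p_{(k,l)})\,(W^u_{(i,j),(k,l)})^*.$$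
   Context: $\mathbb N=\{0,1,2,\dots\}$. A subproduct system (over $\mathbb N^2$) is a family $X=\{X(s)\}_{s\in\mathbb N^2}$ of finite-dimensional complex Hilbert spaces with $\dim X(0)=1$ (so $X(0)=\mathbb C$), together with coisometries $U_{s,t}:X(s)\otimes X(t)\to X(s+t)$ for all $s,t\in\mathbb N^2$, such that $U_{s,0}$ and $U_{0,s}$ are the natural isomorphisms $X(s)\otimes\mathbb C\cong X(s)\cong\mathbb C\otimes X(s)$, and $U_{s+t,r}(U_{s,t}\otimes I_{X(r)})=U_{s,t+r}(I_{X(s)}\otimes U_{t,r})$ for all $s,t,r$. Subproduct systems $X,Y$ are isomorphic if there are unitaries $V_s:X(s)\to Y(\pi(s))$ ($0\ne s\in\mathbb N^2$) with $V_{s+t}U^X_{s,t}=U^Y_{\pi(s),\pi(t)}(V_s\otimes V_t)$ for all nonzero $s,t$, where $\pi:\mathbb N^2\to\mathbb N^2$ is either the identity or the coordinate switch $\pi(i,j)=(j,i)$. Given Hilbert spaces $E,F$ and an operator $u:F\otimes E\to E\otimes F$, define for $n\ge1$ the operator $u^{(1,n)}:F\otimes E^{\otimes n}\to E^{\otimes n}\otimes F$ by $u^{(1,n)}=(I_{E^{\otimes(n-1)}}\otimes u)(I_{E^{\otimes(n-2)}}\otimes u\otimes I_E)\cdots(u\otimes I_{E^{\otimes(n-1)}})$; for $m,n\ge1$ define $u^{(m,n)}:F^{\otimes m}\otimes E^{\otimes n}\to E^{\otimes n}\otimes F^{\otimes m}$ by $u^{(m,n)}=(u^{(1,n)}\otimes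 I_{F^{\otimes(m-1)}})\cdots(I_{F^{\otimes(m-2)}}\otimes u^{(1,n)}\otimes I_F)(I_{F^{\otimes(m-1)}}\otimes u^{(1,n)})$; if $m=0$ or $n=0$, $u^{(m,n)}$ is the identity. Put $W^u_{(i,j),(k,l)}:=I_{E^{\otimes i}}\otimes u^{(j,k)}\otimes I_{F^{\otimes l}}:E^{\otimes i}\otimes F^{\otimes j}\otimes E^{\otimes k}\otimes F^{\otimes l}\to E^{\otimes(i+k)}\otimes F^{\otimes(j+l)}$. Convention: $E^{\otimes0}\otimes F^{\otimes0}=\mathbb C$. *)

(* Defs.v *)
From HB Require Import structures.
From mathcomp Require Import all_boot all_order all_algebra.
From mathcomp Require Import complex reals.

Set Implicit Arguments.
Unset Strict Implicit.
Unset Printing Implicit Defensive.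

Import Order.TTheory GRing.Theory Num.Theory.
Local Open Scope ring_scope.

(* Inner products are linear in the first variable. *)
Record hilb (C : numClosedFieldType) := Hilb {
  hvect :> vectType C;
  hdot : {dot hvect for Num.Def.conjC}
}.

Notation "''[' x , y ]" := (hdot _ x y) : ring_scope.

Section Hilbert.
Variable C : numClosedFieldType.
Implicit Types H K L : hilb C.

Lemma onb_subproof H :
  exists t : (\dim {:H}).-tuple H, orthonormal (hdot H) t.
Proof.
have: forall k, (k <= \dim {:H})%N ->
    exists t : k.-tuple H, orthonormal (hdot H) t.
  elim=> [|k IHk] lek; first by exists [tuple].
  have [t ot] := IHk (ltnW lek).
  have nfull : ~~ ({:H} <= <<t>>)%VS.
    apply/negP => /dimvS; rewrite leqNgt => /negP; apply.
    by apply: leq_ltn_trans (dim_span _) _; rewrite size_tuple.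
  have /subvPn[v _ vNt] := nfull.
  have [x xt [y [vE _ oyt]]] := orthogonal_split (hdot H) t v.
  have y0 : y != 0.
    by apply: contraNneq vNt => y0; rewrite vE y0 addr0.
  have yy0 : hdot H y y != 0 by rewrite dnorm_eq0.
  pose z := (sqrtC (hdot H y y))^-1 *: y.
  exists [tuple of z :: t].
  rewrite [tval _](_ : _ = [:: z] ++ t) // orthonormal_cat; apply/and3P; split=> //.
    rewrite /orthonormal /= !andbT dnormZ normfV ger0_norm ?sqrtC_ge0 ?dnorm_ge0 //.
    by rewrite exprVn sqrtCK mulVf.
  apply/orthogonalP => a b; rewrite inE => /eqP-> bt {a}.
  by rewrite /z linearZl_LR /= (orthogonalP oyt y b (mem_head _ _) bt) mulr0.
by move=> /(_ _ (leqnn _)).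
Qed.

Definition onb H : (\dim {:H}).-tuple H := xchoose (onb_subproof H).

Lemma onb_orthonormal H : orthonormal (hdot H) (onb H).
Proof. exact: xchooseP (onb_subproof H). Qed.

Definition ob H (i : 'I_(\dim {:H})) : H := (onb H)`_i.

Lemma onb_dot H (i j : 'I_(\dim {:H})) :
  '[ob i, ob j] = (i == j)%:R.
Proof.
have oH := onb_orthonormal H; rewrite /ob.
have /orthonormalP [uH ->] := oH; rewrite ?mem_nth ?size_tuple //.
by rewrite nth_uniq ?size_tuple.
Qed.

Lemma onb_basis H : basis_of fullv (onb H).
Proof.
rewrite basisEfree subvf size_tuple leqnn !andbT.
exact: orthonormal_free (onb_orthonormal H).
Qed.

Lemma onb_expand H (x : H) : x = \sum_i '[x, ob i] *: ob i.
Proof.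
rewrite {1}(coord_basis (onb_basis H) (memvf x)); apply: eq_bigr => i _.
congr (_ *: _).
rewrite {2}(coord_basis (onb_basis H) (memvf x)) linear_sumlz /=.
rewrite (bigD1 i) //= linearZl_LR /= onb_dot eqxx mulr1 big1 ?addr0 // => j ji.
by rewrite linearZl_LR /= onb_dot (negPf ji) mulr0.
Qed.

Definition adj H K (f : 'Hom(H, K)) : 'Hom(K, H) :=
  linfun (fun y : K => \sum_i '[y, f (ob i)] *: ob i : H).

Lemma adjP H K (f : 'Hom(H, K)) (x : H) (y : K) :
  '[f x, y] = '[x, adj f y].
Proof.
have lin : linear (fun y : K => \sum_i '[y, f (ob i)] *: ob i : H).
  move=> a u v; rewrite scaler_sumr -big_split /=; apply: eq_bigr => i _.
  by rewrite linearDl linearZl_LR /= scalerDl scalerA.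
pose m := GRing.isLinear.Build C K H _ _ lin.
pose g : {linear K -> H} := HB.pack (fun y : K =>
  \sum_i '[y, f (ob i)] *: ob i : H) m.
have -> : adj f y = g y by exact: (lfunE g).
rewrite {1}(onb_expand x) linear_sum linear_sumlz linear_sumr /=.
apply: eq_bigr => i _; rewrite linearZ /= linearZl_LR linearZr_LR /=.
by rewrite [in RHS]mulrC; congr (_ * _); rewrite [LHS]hermC expr0 mul1r.
Qed.

Definition coisometry H K (f : 'Hom(H, K)) : Prop := (f \o adj f)%VF = \1%VF.

Definition unitary H K (f : 'Hom(H, K)) : Prop :=
  (adj f \o f)%VF = \1%VF /\ (f \o adj f)%VF = \1%VF.

Definition op_le H (A B : 'End(H)) : Prop := forall x : H, 0 <= '[(B - A) x, x].

Section SubHilbert.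
Variables (H : hilb C) (V : {vspace H}).

Definition sub_dot (x y : subvs_of V) : C := '[vsval x, vsval y].

Fact sub_dot_bilinear : bilinear_for
  (GRing.Scale.Law.clone _ _ *%R _)
  (GRing.Scale.Law.clone _ _ (Num.Def.conjC \; *%R) _) sub_dot.
Proof.
by split=> [y a u v | x a u v]; rewrite /sub_dot linearP ?linearPl ?linearPr.
Qed.

HB.instance Definition _ := bilinear_isBilinear.Build C _ _ _ _ _ sub_dot
  sub_dot_bilinear.

Fact sub_dot_hermitian x y :
  sub_dot x y = (-1) ^+ false * Num.Def.conjC (sub_dot y x).
Proof. exact: hermC. Qed.

HB.instance Definition _ := isHermitianSesquilinear.Build C _ false _ sub_dot
  sub_dot_hermitian.

Fact sub_dot_gt0 x : x != 0 -> 0 < sub_dot x x.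
Proof. by move=> x0; rewrite /sub_dot dnorm_gt0. Qed.

HB.instance Definition _ := isDotProduct.Build C _ sub_dot sub_dot_gt0.

Definition hsub : hilb C := @Hilb C (subvs_of V) sub_dot.

Definition incl : 'Hom(hsub, H) := linfun (vsval : hsub -> H).

Definition orthproj : 'End(H) := daddv_pi V (orthov (hdot H) V).

End SubHilbert.

Definition scal_dot (x y : C^o) : C := x * (y : C)^*.

Fact scal_dot_bilinear : bilinear_for
  (GRing.Scale.Law.clone _ _ *%R _)
  (GRing.Scale.Law.clone _ _ (Num.Def.conjC \; *%R) _) scal_dot.
Proof.
split=> [y a u v | x a u v]; rewrite /scal_dot /=.
  by rewrite mulrDl -mulrA.
by rewrite rmorphD rmorphM mulrDr mulrCA.
Qed.

HB.instance Definition _ := bilinear_isBilinear.Build C _ _ _ _ _ scal_dot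
  scal_dot_bilinear.

Fact scal_dot_hermitian x y :
  scal_dot x y = (-1) ^+ false * Num.Def.conjC (scal_dot y x).
Proof. by rewrite /scal_dot expr0 mul1r rmorphM /= conjCK mulrC. Qed.

HB.instance Definition _ := isHermitianSesquilinear.Build C _ false _ scal_dot
  scal_dot_hermitian.

Fact scal_dot_gt0 x : x != 0 -> 0 < scal_dot x x.
Proof. by move=> x0; rewrite /scal_dot mul_conjC_gt0. Qed.

HB.instance Definition _ := isDotProduct.Build C _ scal_dot scal_dot_gt0.

Definition scal : hilb C := @Hilb C C^o scal_dot.

(* H (x) K is the space of coordinate matrices with respect to the orthonormal
   bases [onb H] and [onb K]; [dot_pure], [tliftE] and [tens_ext] say that
   [pure : H -> K -> tens H K] is the Hilbert space tensor product. *)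
Definition tens H K : hilb C :=
  @Hilb C 'rV[C]_(\dim {:H} * \dim {:K}) (@dotmx C _).

Definition pure H K (x : H) (y : K) : tens H K :=
  mxvec (\matrix_(i < \dim {:H}, j < \dim {:K}) ('[x, ob i] * '[y, ob j])).

(* Only meaningful for a bilinear f, see [tliftE]. *)
Definition tlift H K L (f : H -> K -> L) : 'Hom(tens H K, L) :=
  linfun (fun t : tens H K =>
    \sum_(i < \dim {:H}) \sum_(j < \dim {:K})
      t 0 (mxvec_index i j) *: f (ob i) (ob j) : L).

Lemma dot_ob H (x y : H) : '[x, y] = \sum_i '[x, ob i] * ('[y, ob i])^*.
Proof.
rewrite {1}(onb_expand y) linear_sumr /=; apply: eq_bigr => i _.
by rewrite linearZr_LR /= mulrC.
Qed.

Lemma pureE H K (x : H) (y : K) i j :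
  (pure x y : 'rV_(_ * _)) 0 (mxvec_index i j) = '[x, ob i] * '[y, ob j].
Proof. by rewrite mxvecE mxE. Qed.

Lemma dot_pure H K (x x' : H) (y y' : K) :
  '[pure x y, pure x' y'] = '[x, x'] * '[y, y'].
Proof.
rewrite (dot_ob x x') (dot_ob y y') big_distrlr /= dotmxE mxE.
rewrite (reindex _ (curry_mxvec_bij _ _)) /= pair_bigA /=.
apply: eq_bigr => -[i j] _ /=; rewrite !mxE !pureE rmorphM /=.
by rewrite mulrACA.
Qed.

Lemma pure_linearl H K (y : K) : linear (fun x : H => pure x y).
Proof.
move=> a u v; rewrite /pure -linearP; congr mxvec; apply/matrixP => i j.
by rewrite !mxE linearPl mulrDl mulrA.
Qed.

Lemma pure_linearr H K (x : H) : linear (pure x : K -> tens H K).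
Proof.
move=> a u v; rewrite /pure -linearP; congr mxvec; apply/matrixP => i j.
by rewrite !mxE linearPl mulrDr mulrCA.
Qed.

Lemma lfun_linear H K (f : H -> K) (x : H) : linear f -> linfun f x = f x.
Proof.
move=> lin; pose m := GRing.isLinear.Build C H K _ f lin.
pose g : {linear H -> K} := HB.pack f m.
exact: (lfunE g).
Qed.

Lemma linear_ob H K (f : H -> K) (x : H) : linear f ->
  f x = \sum_i '[x, ob i] *: f (ob i).
Proof.
move=> lin; rewrite -lfun_linear // {1}(onb_expand x) linear_sum /=.
by apply: eq_bigr => i _; rewrite linearZ /= lfun_linear.
Qed.

Lemma tlift_sum H K L (f : H -> K -> L) (t : tens H K) :
  tlift f t = \sum_i \sum_j t 0 (mxvec_index i j) *: f (ob i) (ob j).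
Proof.
rewrite /tlift lfun_linear // => a u v.
rewrite scaler_sumr -big_split /=; apply: eq_bigr => i _.
rewrite scaler_sumr -big_split /=; apply: eq_bigr => j _.
by rewrite !mxE scalerDl scalerA.
Qed.

Lemma tliftE H K L (f : H -> K -> L) (x : H) (y : K) :
  (forall y, linear (f^~ y)) -> (forall x, linear (f x)) ->
  tlift f (pure x y) = f x y.
Proof.
move=> linl linr; rewrite tlift_sum (linear_ob x (linl y)) /=.
apply: eq_bigr => i _; rewrite (linear_ob y (linr _)) scaler_sumr.
by apply: eq_bigr => j _; rewrite pureE scalerA.
Qed.

Lemma tens_ext H K L (f g : 'Hom(tens H K, L)) :
  (forall x y, f (pure x y) = g (pure x y)) -> f = g.
Proof.
move=> fg; apply/lfunP => t; rewrite [t]row_sum_delta !linear_sum /=.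
apply: eq_bigr => k _; rewrite !linearZ /=; congr (_ *: _).
case/mxvec_indexP: k => i j.
suff -> : delta_mx 0 (mxvec_index i j) = pure (ob i) (ob j) by [].
rewrite /pure -mxvec_delta; congr mxvec; apply/matrixP => a b.
by rewrite !mxE !onb_dot -natrM mulnb (eq_sym a) (eq_sym b).
Qed.

Definition tmap H H' K K' (f : 'Hom(H, H')) (g : 'Hom(K, K')) :
    'Hom(tens H K, tens H' K') :=
  tlift (fun x y => pure (f x) (g y)).

Lemma tmapE H H' K K' (f : 'Hom(H, H')) (g : 'Hom(K, K')) x y :
  tmap f g (pure x y) = pure (f x) (g y).
Proof.
apply: tliftE => [{}y a u v|{}x a u v].
  by rewrite linearP pure_linearl.
by rewrite linearP pure_linearr.
Qed.

Definition assoc H K L : 'Hom(tens (tens H K) L, tens H (tens K L)) :=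
  tlift (fun t z => tlift (fun x y => pure x (pure y z)) t).

Definition assocV H K L : 'Hom(tens H (tens K L), tens (tens H K) L) :=
  tlift (fun x t => tlift (fun y z => pure (pure x y) z) t).

Definition lunit H : 'Hom(tens scal H, H) := tlift (fun (a : scal) x => a *: x).

Definition lunitV H : 'Hom(H, tens scal H) := linfun (pure (1 : scal)).

Definition runit H : 'Hom(tens H scal, H) := tlift (fun x (a : scal) => a *: x).

Definition runitV H : 'Hom(H, tens H scal) :=
  linfun (fun x : H => pure x (1 : scal)).

Lemma assocE H K L (x : H) (y : K) (z : L) :
  assoc H K L (pure (pure x y) z) = pure x (pure y z).
Proof.
have b1 z' : forall y', linear (fun x' : H => pure x' (pure y' z')).
  by move=> y' a u v; rewrite pure_linearl.
have b2 z' : forall x' : H, linear (fun y' : K => pure x' (pure y' z')).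
  by move=> x' a u v; rewrite pure_linearl pure_linearr.
rewrite /assoc tliftE ?tliftE // => [z' a u v|t a u v]; first by rewrite linearP.
rewrite !tlift_sum scaler_sumr -big_split /=; apply: eq_bigr => i _.
rewrite scaler_sumr -big_split /=; apply: eq_bigr => j _.
by rewrite !pure_linearr scalerDr !scalerA mulrC.
Qed.

Lemma assocVE H K L (x : H) (y : K) (z : L) :
  assocV H K L (pure x (pure y z)) = pure (pure x y) z.
Proof.
have b1 x' : forall z', linear (fun y' : K => pure (pure x' y') z').
  by move=> z' a u v; rewrite pure_linearr pure_linearl.
have b2 x' : forall y' : K, linear (fun z' : L => pure (pure x' y') z').
  by move=> y' a u v; rewrite pure_linearr.
rewrite /assocV tliftE ?tliftE // => [t a u v|x' a u v]; last by rewrite linearP.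
rewrite !tlift_sum scaler_sumr -big_split /=; apply: eq_bigr => i _.
rewrite scaler_sumr -big_split /=; apply: eq_bigr => j _.
by rewrite !pure_linearl scalerDr !scalerA mulrC.
Qed.

Lemma lunitE H (a : scal) (x : H) : lunit H (pure a x) = a *: x.
Proof.
apply: tliftE => [y c u v|b c u v]; first by rewrite scalerDl scalerA.
by rewrite scalerDr !scalerA mulrC.
Qed.

Lemma runitE H (x : H) (a : scal) : runit H (pure x a) = a *: x.
Proof.
apply: tliftE => [y c u v|b c u v]; last by rewrite scalerDl scalerA.
by rewrite scalerDr !scalerA mulrC.
Qed.

Lemma lunitVE H (x : H) : lunitV H x = pure (1 : scal) x.
Proof. by rewrite /lunitV lfun_linear //; apply: pure_linearr. Qed.

Lemma runitVE H (x : H) : runitV H x = pure x (1 : scal).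
Proof. by rewrite /runitV lfun_linear //; apply: pure_linearl. Qed.

Fixpoint tpow H (n : nat) : hilb C :=
  if n is n'.+1 then tens H (tpow H n') else scal.

Fixpoint tpow_cat H (m n : nat) :
    'Hom(tens (tpow H m) (tpow H n), tpow H (m + n)%N) :=
  match m with
  | 0 => lunit (tpow H n)
  | m'.+1 => (tmap \1%VF (tpow_cat H m' n) \o assoc H (tpow H m') (tpow H n))%VF
  end.

Section Twist.
Variables (E F : hilb C) (u : 'Hom(tens F E, tens E F)).

(* u^(1,n.+1) = (I_E (x) u^(1,n)) (u (x) I_{E^(x)n}). *)
Fixpoint twist1 (n : nat) : 'Hom(tens F (tpow E n), tens (tpow E n) F) :=
  match n with
  | 0 => (lunitV F \o runit F)%VF
  | n'.+1 =>
      (assocV E (tpow E n') F \o tmap \1 (twist1 n') \o assoc E F (tpow E n')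
        \o tmap u \1 \o assocV F E (tpow E n'))%VF
  end.

(* u^(m.+1,n) = (u^(1,n) (x) I_{F^(x)m}) (I_F (x) u^(m,n)). *)
Fixpoint twist (m n : nat) :
    'Hom(tens (tpow F m) (tpow E n), tens (tpow E n) (tpow F m)) :=
  match m with
  | 0 => (runitV (tpow E n) \o lunit (tpow E n))%VF
  | m'.+1 =>
      (assoc (tpow E n) F (tpow F m') \o tmap (twist1 n) \1
        \o assocV F (tpow E n) (tpow F m') \o tmap \1 (twist m' n)
        \o assoc F (tpow F m') (tpow E n))%VF
  end.

(* E^(x)m (x) F^(x)n for s = (m, n). *)
Definition EF (s : nat * nat) : hilb C := tens (tpow E s.1) (tpow F s.2).

(* tpow E 1 is tens E scal, not E itself: this is the identification of
   E (x) F with E^(x)1 (x) F^(x)1. *)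
Definition EF11 : 'Hom(tens E F, EF (1, 1)%N) := tmap (runitV E) (runitV F).

(* I_{E^(x)i} (x) u^(j,k) (x) I_{F^(x)l} for s = (i, j) and t = (k, l). *)
Definition W (s t : nat * nat) : 'Hom(tens (EF s) (EF t), EF (s + t)) :=
  (tmap (tpow_cat E s.1 t.1) (tpow_cat F s.2 t.2)
    \o assocV (tpow E s.1) (tpow E t.1) (tens (tpow F s.2) (tpow F t.2))
    \o tmap \1
        (assoc (tpow E t.1) (tpow F s.2) (tpow F t.2)
          \o tmap (twist s.2 t.1) \1
          \o assocV (tpow F s.2) (tpow E t.1) (tpow F t.2))
    \o assoc (tpow E s.1) (tpow F s.2) (EF t))%VF.

End Twist.

(* s + t + r and s + (t + r) are not convertible indices, hence this transport. *)
Definition hcast (X : nat * nat -> hilb C) s t (e : s = t) : 'Hom(X s, X t) :=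
  ecast r 'Hom(X s, X r) e \1%VF.

(* The unit vector [vac] is the 1 of X(0) = C. *)
Record subproduct (X : nat * nat -> hilb C) := Subproduct {
  vac : X 0;
  smul : forall s t, 'Hom(tens (X s) (X t), X (s + t));
  dim_X0 : \dim {:X 0} = 1%N;
  dot_vac : '[vac, vac] = 1;
  smul_coisometry : forall s t, coisometry (smul s t);
  smul_vacr : forall s (x : X s),
    hcast X (addr0 s) (smul s 0 (pure x vac)) = x;
  smul_vacl : forall s (x : X s),
    hcast X (add0r s) (smul 0 s (pure vac x)) = x;
  smulA : forall s t r,
    (smul (s + t) r \o tmap (smul s t) \1)%VF =
    (hcast X (addrA s t r) \o smul s (t + r) \o tmap \1 (smul t r)
      \o assoc (X s) (X t) (X r))%VF
}.

Definition isomorphic_via (pi : nat * nat -> nat * nat)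
    (piD : forall s t, pi (s + t) = pi s + pi t)
    (X Y : nat * nat -> hilb C) (SX : subproduct X) (SY : subproduct Y) : Prop :=
  exists V : forall s, 'Hom(X s, Y (pi s)),
    (forall s, s != 0 -> unitary (V s)) /\
    (forall s t, s != 0 -> t != 0 ->
       (hcast Y (piD s t) \o V (s + t) \o smul SX s t)%VF =
       (smul SY (pi s) (pi t) \o tmap (V s) (V t))%VF).

Definition swap (s : nat * nat) : nat * nat := (s.2, s.1).

Definition isomorphic (X Y : nat * nat -> hilb C)
    (SX : subproduct X) (SY : subproduct Y) : Prop :=
  @isomorphic_via id (fun _ _ => erefl) X Y SX SY \/
  @isomorphic_via swap (fun _ _ => erefl) X Y SX SY.

End Hilbert.

(* Keep [hvect (tens H K)] folded, so that [pure] and [tmap] remain visible. *)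
Arguments tens : simpl never.
Arguments scal : simpl never.
Arguments hsub : simpl never.

(* Main.v *)
Require Import Defs.
From HB Require Import structures.
From mathcomp Require Import all_boot all_order all_algebra.
From mathcomp Require Import complex reals.

Set Implicit Arguments.
Unset Strict Implicit.
Unset Printing Implicit Defensive.
Import Order.TTheory GRing.Theory Num.Theory.
Local Open Scope ring_scope.

(** Every element of a subproduct system [X] is a sum of products of elements
    of [E = X (1, 0)] and [F = X (0, 1)], since the multiplications are
    surjective.  Writing the letters of [E] first, multiplication of words is
    a coisometry [wordmul s] from [EF E F s] onto [X s], so its adjoint is an
    isometric copy of [X s] inside [EF E F s]; this copy is [model s], and the
    projection onto it is [adj (wordmul s) \o wordmul s] ([orthproj_model]).
    The product of [X], carried over by these isometries ([transport]), is the
    product of the isomorphic system.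

    For a unitary [u], the condition on its compression to [model (1, 1)] says
    exactly that [u] rewrites a product [f e] as a combination of products
    [e' f'] with the same value in [X (1, 1)] ([admissibleP]).  Such a [u]
    exists because two coisometries with the same target and sources of the
    same dimension have kernels of the same dimension, hence differ by a
    unitary ([unitary_lift]).

    Sorting the letters of a concatenated word by repeated use of [u] then
    leaves its value unchanged: [wordmul (s + t) \o W u s t] is the product of
    [wordmul s] and [wordmul t] ([wordmul_W]).  Composing with
    [adj (wordmul (s + t))] gives the formula for the product of the model.
    For the inequalities, the same identity shows that [wordmul (s + t) \o W u s t]
    factors through [wordmul s] on the left tensor factor, followed by
    a contraction, and likewise on the right ([op_le_pullback]). *)

(** * Adjoints and coisometries on tensor products *)

Section HilbertSpaces.
Variable C : numClosedFieldType.
Implicit Types H K L E F : hilb C.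

Lemma dotC H (x y : H) : '[x, y] = ('[y, x])^*.
Proof. by rewrite [LHS]hermC expr0 mul1r. Qed.

Lemma dot_inj H (x y : H) : (forall z, '[z, x] = '[z, y]) -> x = y.
Proof.
move=> xy; apply/eqP; rewrite -subr_eq0 -(dnorm_eq0 (hdot H)).
by rewrite linearB /= xy subrr.
Qed.

Lemma adj_unique H K (f : 'Hom(H, K)) (g : 'Hom(K, H)) :
  (forall x y, '[f x, y] = '[x, g y]) -> adj f = g.
Proof.
by move=> fg; apply/lfunP => y; apply: dot_inj => z; rewrite -adjP fg.
Qed.

Lemma adjK H K (f : 'Hom(H, K)) : adj (adj f) = f.
Proof. by apply: adj_unique => x y; rewrite dotC -adjP -dotC. Qed.

Lemma adj_dot H K (f : 'Hom(H, K)) x y : '[adj f y, x] = '[y, f x].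
Proof. by rewrite adjP adjK. Qed.

Lemma adj_comp H K L (f : 'Hom(K, L)) (g : 'Hom(H, K)) :
  adj (f \o g)%VF = (adj g \o adj f)%VF.
Proof. by apply: adj_unique => x y; rewrite !comp_lfunE !adjP. Qed.

Lemma adj_id H : adj (\1%VF : 'End(H)) = \1%VF.
Proof. by apply: adj_unique => x y; rewrite !id_lfunE. Qed.

Lemma adjD H K (f g : 'Hom(H, K)) : adj (f + g) = adj f + adj g.
Proof.
by apply: adj_unique => x y; rewrite !add_lfunE linearDl linearDr /= !adjP.
Qed.

(** Pure tensors span, so a property stable under linear combinations may be
    checked on them; unlike [tens_ext], this applies inside larger expressions
    such as inner products and iterated tensors. *)
Lemma tens_ind H K (P : tens H K -> Prop) :
  (forall x y, P (pure x y)) ->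
  (forall a u v, P u -> P v -> P (a *: u + v)) -> forall t, P t.
Proof.
move=> Ppure Plin t.
have P0 : P 0.
  by have := Plin (-1) _ _ (Ppure 0 0) (Ppure 0 0); rewrite scaleN1r addNr.
rewrite [t]row_sum_delta; elim/big_rec: _ => // k v _ Pv; apply: Plin => //.
case/mxvec_indexP: k => i j.
suff -> : delta_mx 0 (mxvec_index i j) = pure (ob i) (ob j) by [].
rewrite /pure -mxvec_delta; congr mxvec; apply/matrixP => a b.
by rewrite !mxE !onb_dot -natrM mulnb (eq_sym a) (eq_sym b).
Qed.

Lemma tens_ind_assoc H K L (P : tens (tens H K) L -> Prop) :
  (forall x y z, P (pure (pure x y) z)) ->
  (forall a u v, P u -> P v -> P (a *: u + v)) -> forall t, P t.
Proof.
move=> Ppure Plin; apply: tens_ind => // t z.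
by elim/tens_ind: t => // a u v Pu Pv; rewrite pure_linearl; apply: Plin.
Qed.

Lemma tens_ind_assocV H K L (P : tens H (tens K L) -> Prop) :
  (forall x y z, P (pure x (pure y z))) ->
  (forall a u v, P u -> P v -> P (a *: u + v)) -> forall t, P t.
Proof.
move=> Ppure Plin; apply: tens_ind => // x t.
by elim/tens_ind: t => // a u v Pu Pv; rewrite pure_linearr; apply: Plin.
Qed.

Lemma dim_tens H K : \dim {:tens H K} = (\dim {:H} * \dim {:K})%N.
Proof. exact: etrans (dimvf _) (mul1n _). Qed.

Lemma adj_tmap H H' K K' (f : 'Hom(H, H')) (g : 'Hom(K, K')) :
  adj (tmap f g) = tmap (adj f) (adj g).
Proof.
apply: adj_unique => s t; elim/tens_ind: s => [x y|a u v IHu IHv]; last first.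
  by rewrite linearP !linearPl /= IHu IHv.
elim/tens_ind: t => [x' y'|a u v IHu IHv]; last first.
  by rewrite !linearP /= IHu IHv.
by rewrite !tmapE !dot_pure !adjP.
Qed.

Lemma adj_assoc H K L : adj (assoc H K L) = assocV H K L.
Proof.
apply: adj_unique => s t.
elim/tens_ind_assoc: s => [x y z|a u v IHu IHv]; last first.
  by rewrite linearP !linearPl /= IHu IHv.
elim/tens_ind_assocV: t => [x' y' z'|a u v IHu IHv]; last first.
  by rewrite !linearP /= IHu IHv.
by rewrite assocE assocVE !dot_pure mulrA.
Qed.

Lemma assocK H K L : (assoc H K L \o assocV H K L)%VF = \1%VF.
Proof.
apply/lfunP => t; elim/tens_ind_assocV: t => [x y z|a u v IHu IHv].
  by rewrite comp_lfunE id_lfunE assocVE assocE.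
by rewrite !linearP /= IHu IHv.
Qed.

Lemma assocVK H K L : (assocV H K L \o assoc H K L)%VF = \1%VF.
Proof.
apply/lfunP => t; elim/tens_ind_assoc: t => [x y z|a u v IHu IHv].
  by rewrite comp_lfunE id_lfunE assocE assocVE.
by rewrite !linearP /= IHu IHv.
Qed.

Lemma tmap_comp H H' H'' K K' K'' (f : 'Hom(H, H')) (f' : 'Hom(H', H''))
    (g : 'Hom(K, K')) (g' : 'Hom(K', K'')) :
  tmap (f' \o f) (g' \o g) = (tmap f' g' \o tmap f g)%VF.
Proof. by apply: tens_ext => x y; rewrite comp_lfunE !tmapE !comp_lfunE. Qed.

Lemma tmap1 H K : tmap (\1 : 'End(H)) (\1 : 'End(K)) = \1%VF.
Proof. by apply: tens_ext => x y; rewrite tmapE !id_lfunE. Qed.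

Lemma adj_lunit H : adj (lunit H) = lunitV H.
Proof.
apply: adj_unique => t y; elim/tens_ind: t => [a x|a u v IHu IHv]; last first.
  by rewrite linearP !linearPl /= IHu IHv.
rewrite lunitE lunitVE dot_pure linearZl_LR /=; congr (_ * _).
by rewrite /hdot /= /scal_dot conjC1 mulr1.
Qed.

Lemma adj_runit H : adj (runit H) = runitV H.
Proof.
apply: adj_unique => t y; elim/tens_ind: t => [x a|a u v IHu IHv]; last first.
  by rewrite linearP !linearPl /= IHu IHv.
rewrite runitE runitVE dot_pure linearZl_LR /= mulrC; congr (_ * _).
by rewrite /hdot /= /scal_dot conjC1 mulr1.
Qed.

Lemma coisometry_comp H K L (f : 'Hom(K, L)) (g : 'Hom(H, K)) :
  coisometry f -> coisometry g -> coisometry (f \o g)%VF.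
Proof.
move=> cf cg; rewrite /coisometry adj_comp -comp_lfunA.
by rewrite (comp_lfunA g) cg comp_lfun1l.
Qed.

Lemma coisometry1 H : coisometry (\1%VF : 'End(H)).
Proof. by rewrite /coisometry adj_id comp_lfun1l. Qed.

Lemma coisometry_tmap H H' K K' (f : 'Hom(H, H')) (g : 'Hom(K, K')) :
  coisometry f -> coisometry g -> coisometry (tmap f g).
Proof. by move=> cf cg; rewrite /coisometry adj_tmap -tmap_comp cf cg tmap1. Qed.

Lemma coisometry_assoc H K L : coisometry (assoc H K L).
Proof. by rewrite /coisometry adj_assoc assocK. Qed.

Lemma coisometry_assocV H K L : coisometry (assocV H K L).
Proof. by rewrite /coisometry -adj_assoc adjK adj_assoc assocVK. Qed.

Lemma coisometry_lunit H : coisometry (lunit H).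
Proof.
rewrite /coisometry adj_lunit; apply/lfunP => x.
by rewrite comp_lfunE id_lfunE lunitVE lunitE scale1r.
Qed.

Lemma pureZl H K a (x : H) (y : K) : pure (a *: x) y = a *: pure x y.
Proof.
have p0 : pure 0 y = 0 :> tens H K.
  by have := pure_linearl y (-1) 0 (0 : H); rewrite scaler0 addr0 scaleN1r addNr.
by have := pure_linearl y a x 0; rewrite !addr0 p0 addr0.
Qed.

Lemma pureZr H K a (x : H) (y : K) : pure x (a *: y) = a *: pure x y.
Proof.
have p0 : pure x 0 = 0 :> tens H K.
  by have := pure_linearr x (-1) 0 (0 : K); rewrite scaler0 addr0 scaleN1r addNr.
by have := pure_linearr x a y 0; rewrite !addr0 p0 addr0.
Qed.

Lemma coisometry_lunitV H : coisometry (lunitV H).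
Proof.
rewrite /coisometry -{2}adj_lunit adjK; apply: tens_ext => a x.
rewrite comp_lfunE id_lfunE lunitVE lunitE pureZr -pureZl.
by congr (pure _ _); apply: mulr1.
Qed.

Lemma coisometry_runitV H : coisometry (runitV H).
Proof.
rewrite /coisometry -{2}adj_runit adjK; apply: tens_ext => x a.
rewrite comp_lfunE id_lfunE runitVE runitE pureZl -pureZr.
by congr (pure _ _); apply: mulr1.
Qed.

Lemma coisometry_runit H : coisometry (runit H).
Proof.
rewrite /coisometry adj_runit; apply/lfunP => x.
by rewrite comp_lfunE id_lfunE runitVE runitE scale1r.
Qed.

(** The equations [tpow_catS], [twist1S], [twistS] and [WE] hold by definition;
    rewriting with them, instead of simplifying, keeps the intermediate spaces
    in the form [tens _ _] on which lemmas about [tmap] and [pure] apply. *)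
Lemma tpow_catS H m n : tpow_cat H m.+1 n =
  (tmap \1 (tpow_cat H m n) \o assoc H (tpow H m) (tpow H n))%VF.
Proof. by []. Qed.

Lemma coisometry_tpow_cat H m n : coisometry (tpow_cat H m n).
Proof.
elim: m => [|m IHm]; first exact: coisometry_lunit.
rewrite tpow_catS; apply: coisometry_comp (coisometry_assoc _ _ _).
by apply: coisometry_tmap IHm; apply: coisometry1.
Qed.

Ltac coisometries := repeat match goal with
  | |- @coisometry _ _ _ (@comp_lfun _ _ _ _ _ _) => apply: coisometry_comp
  | |- @coisometry _ _ _ (@tmap _ _ _ _ _ _ _) => apply: coisometry_tmap
  | |- @coisometry _ _ _ (@id_lfun _ _) => exact: coisometry1
  | |- @coisometry _ _ _ (@assoc _ _ _ _) => exact: coisometry_assoc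
  | |- @coisometry _ _ _ (@assocV _ _ _ _) => exact: coisometry_assocV
  end.

Lemma twist1S E F (u : 'Hom(tens F E, tens E F)) n :
  twist1 u n.+1 = (assocV E (tpow E n) F \o tmap \1 (twist1 u n)
    \o assoc E F (tpow E n) \o tmap u \1 \o assocV F E (tpow E n))%VF.
Proof. by []. Qed.

Lemma coisometry_twist1 E F (u : 'Hom(tens F E, tens E F)) n :
  coisometry u -> coisometry (twist1 u n).
Proof.
move=> cu; elim: n => [|n IHn].
  exact: coisometry_comp (coisometry_lunitV _) (coisometry_runit _).
by rewrite twist1S; coisometries.
Qed.

Lemma twistS E F (u : 'Hom(tens F E, tens E F)) m n :
  twist u m.+1 n = (assoc (tpow E n) F (tpow F m) \o tmap (twist1 u n) \1
    \o assocV F (tpow E n) (tpow F m) \o tmap \1 (twist u m n)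
    \o assoc F (tpow F m) (tpow E n))%VF.
Proof. by []. Qed.

Lemma coisometry_twist E F (u : 'Hom(tens F E, tens E F)) m n :
  coisometry u -> coisometry (twist u m n).
Proof.
move=> cu; elim: m => [|m IHm].
  exact: coisometry_comp (coisometry_runitV _) (coisometry_lunit _).
by rewrite twistS; coisometries => //; apply: coisometry_twist1.
Qed.

Lemma WE E F (u : 'Hom(tens F E, tens E F)) s t :
  W u s t = (tmap (tpow_cat E s.1 t.1) (tpow_cat F s.2 t.2)
    \o assocV (tpow E s.1) (tpow E t.1) (tens (tpow F s.2) (tpow F t.2))
    \o tmap \1
        (assoc (tpow E t.1) (tpow F s.2) (tpow F t.2)
          \o tmap (twist u s.2 t.1) \1
          \o assocV (tpow F s.2) (tpow E t.1) (tpow F t.2))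
    \o assoc (tpow E s.1) (tpow F s.2) (EF E F t))%VF.
Proof. by []. Qed.

Lemma coisometry_W E F (u : 'Hom(tens F E, tens E F)) s t :
  coisometry u -> coisometry (W u s t).
Proof.
move=> cu; rewrite WE.
by coisometries; [apply: coisometry_tpow_cat..|apply: coisometry_twist].
Qed.

Lemma coisometryK H K (f : 'Hom(H, K)) y : coisometry f -> f (adj f y) = y.
Proof. by move=> cf; rewrite -comp_lfunE cf id_lfunE. Qed.

(** The defect is the squared norm of [x - adj f (f x)]. *)
Lemma coisometry_contract H K (f : 'Hom(H, K)) x :
  coisometry f -> '[f x, f x] <= '[x, x].
Proof.
move=> cf; have := dnorm_ge0 (hdot H) (x - adj f (f x)).
rewrite linearBl !linearB /= (dotC (adj _ _) x) -!adjP coisometryK // -dotC.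
by rewrite subrr subr0 subr_ge0.
Qed.

(** * Orthogonal projections and unitary completion *)

Lemma orthov_disjoint H (V : {vspace H}) : (V :&: orthov (hdot H) V = 0)%VS.
Proof.
apply/eqP; rewrite -subv0; apply/subvP => y.
rewrite memv_cap memv0 => /andP[yV /mem_orthovP/(_ _ yV)] /eqP.
by rewrite dnorm_eq0.
Qed.

Lemma orthproj_id H (V : {vspace H}) x : x \in V -> orthproj V x = x.
Proof. exact/daddv_pi_id/orthov_disjoint. Qed.

Lemma dot_incl H (V : {vspace H}) (x y : hsub V) : '[incl V x, incl V y] = '[x, y].
Proof. by rewrite /incl !lfunE. Qed.

Lemma incl_mem H (V : {vspace H}) (x : hsub V) : incl V x \in V.
Proof. by rewrite /incl lfunE; apply: subvsP. Qed.

Lemma adj_inclK H (V : {vspace H}) : (adj (incl V) \o incl V)%VF = \1%VF.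
Proof.
apply/lfunP => x; apply: dot_inj => z.
by rewrite comp_lfunE id_lfunE -adjP dot_incl.
Qed.

Lemma incl_surj H (V : {vspace H}) x : x \in V -> exists y, incl V y = x.
Proof. by move=> xV; exists (vsproj V x); rewrite /incl lfunE; apply: vsprojK. Qed.

(** The defining properties of [p] force [x - p x] to be orthogonal to [V]. *)
Lemma orthproj_unique H (V : {vspace H}) (p : 'End(H)) :
  adj p = p -> (forall x, p x \in V) -> (forall x, x \in V -> p x = x) ->
  orthproj V = p.
Proof.
move=> pa pV pid; apply/lfunP => x.
have disj := orthov_disjoint V.
have xp : x - p x \in orthov (hdot H) V.
  apply/mem_orthovP => v vV.
  by rewrite linearBl /= adjP pa pid // subrr.
have proj0 : orthproj V (x - p x) = 0.
  set z := x - p x in xp *; have zVV : z \in (V + orthov (hdot H) V)%VS.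
    by apply: subvP xp; apply: addvSr.
  have disj' : (orthov (hdot H) V :&: V = 0)%VS by rewrite capvC.
  have := daddv_pi_add disj zVV; rewrite (daddv_pi_id disj' xp) => /eqP.
  by rewrite -subr_eq0 addrK => /eqP.
by rewrite -{1}[x](subrK (p x)) linearD /= proj0 add0r orthproj_id.
Qed.

Lemma orthproj_incl H (V : {vspace H}) :
  orthproj V = (incl V \o adj (incl V))%VF.
Proof.
apply: orthproj_unique => [|x|x xV]; first by rewrite adj_comp adjK.
  by rewrite comp_lfunE incl_mem.
have [y <-] := incl_surj xV.
by rewrite comp_lfunE -(comp_lfunE (adj _)) adj_inclK id_lfunE.
Qed.

Lemma orthproj_limg H K (f : 'Hom(H, K)) :
  coisometry f -> orthproj (limg (adj f)) = (adj f \o f)%VF.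
Proof.
move=> cf; apply: orthproj_unique => [|x|_ /memv_imgP[x _ ->]].
- by rewrite adj_comp adjK.
- by rewrite comp_lfunE memv_img ?memvf.
- by rewrite -comp_lfunE -comp_lfunA cf comp_lfun1r.
Qed.

Lemma orthproj_lker H K (f : 'Hom(H, K)) :
  coisometry f -> orthproj (lker f) = \1%VF - (adj f \o f)%VF.
Proof.
move=> cf; apply: orthproj_unique => [|x|x].
- apply: adj_unique => x y; rewrite !lfunE /= !lfunE /= linearBl linearBr /=.
  by rewrite !lfunE /= !adjP adjK.
- rewrite memv_ker !lfunE /= !lfunE /= linearB /= lfunE /=.
  by rewrite -[X in f x - X]/(f (adj f (f x))) coisometryK // subrr.
- by rewrite memv_ker !lfunE /= !lfunE /= lfunE /= => /eqP ->; rewrite linear0 subr0.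
Qed.

(** Matching the chosen orthonormal bases index by index. *)
Lemma unitary_eq_dim H K :
  \dim {:H} = \dim {:K} -> exists f : 'Hom(H, K), unitary f.
Proof.
move=> eqd; pose f : 'Hom(H, K) :=
  linfun (fun x => \sum_i '[x, ob i] *: ob (cast_ord eqd i) : K).
have fE x : f x = \sum_i '[x, ob i] *: ob (cast_ord eqd i).
  rewrite /f lfun_linear // => a u v; rewrite scaler_sumr -big_split /=.
  by apply: eq_bigr => i _; rewrite linearDl linearZl_LR /= scalerDl scalerA.
have fob i : f (ob i) = ob (cast_ord eqd i).
  rewrite fE (bigD1 i) //= onb_dot eqxx scale1r big1 ?addr0 // => j ji.
  by rewrite onb_dot eq_sym (negPf ji) scale0r.
have afob j : adj f (ob j) = ob (cast_ord (esym eqd) j).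
  apply: dot_inj => x; rewrite -adjP fE linear_sumlz /=.
  rewrite (bigD1 (cast_ord (esym eqd) j)) //= big1 => [|i ij].
    by rewrite addr0 linearZl_LR /= cast_ordKV onb_dot eqxx mulr1.
  rewrite linearZl_LR /= onb_dot -(inj_eq (@cast_ord_inj _ _ (esym eqd))).
  by rewrite cast_ordK (negPf ij) mulr0.
exists f; split; apply/lfunP => x; rewrite (onb_expand x) !linear_sum /=.
  apply: eq_bigr => i _; rewrite !linearZ /= comp_lfunE id_lfunE.
  by rewrite fob afob cast_ordK.
apply: eq_bigr => i _; rewrite !linearZ /= comp_lfunE id_lfunE.
by rewrite afob fob cast_ordKV.
Qed.

Lemma coisometry_limg H K (f : 'Hom(H, K)) : coisometry f -> limg f = fullv.
Proof.
move=> cf; apply/eqP; rewrite eqEsubv subvf; apply/subvP => y _.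
by rewrite -(coisometryK y cf) memv_img ?memvf.
Qed.

Lemma lker_incl H K (f : 'Hom(H, K)) x : f (incl (lker f) x) = 0.
Proof. by apply/eqP; rewrite -memv_ker incl_mem. Qed.

Lemma adj_lker_incl H K (f : 'Hom(H, K)) y : adj (incl (lker f)) (adj f y) = 0.
Proof.
by apply: dot_inj => z; rewrite -!adjP lker_incl linear0l linear0r.
Qed.

(** The splitting of the source into the initial space of [f], a copy of its
    target, and the kernel of [f]. *)
Lemma coisometry_decomp H K (f : 'Hom(H, K)) x : coisometry f ->
  adj f (f x) + incl (lker f) (adj (incl (lker f)) x) = x.
Proof.
move=> cf; rewrite -[X in _ + X]comp_lfunE -orthproj_incl orthproj_lker //.
by rewrite !lfunE /= !lfunE /= lfunE /= addrC subrK.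
Qed.

(** On the initial space of [N], [u] must agree with [adj M \o N] up to the
    kernel of [M]; the kernels of [M] and [N] have the same dimension by
    rank-nullity, and any unitary between them completes [adj M \o N] to a
    unitary. *)
Lemma unitary_lift H K L (M : 'Hom(H, L)) (N : 'Hom(K, L)) :
  coisometry M -> coisometry N -> \dim {:H} = \dim {:K} ->
  exists2 u : 'Hom(K, H), unitary u & (M \o u)%VF = N.
Proof.
move=> cM cN eqd.
have eqk : \dim {:hsub (lker N)} = \dim {:hsub (lker M)}.
  have := limg_ker_dim M fullv; have := limg_ker_dim N fullv.
  rewrite !capfv !coisometry_limg // -eqd => <- /addIn.
  by move=> e; exact: etrans (dimvf _) (etrans (esym e) (esym (dimvf _))).
have [f [f1 f2]] := unitary_eq_dim eqk.
have ff x : f (adj f x) = x by rewrite coisometryK.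
have ff' x : adj f (f x) = x by rewrite -comp_lfunE f1 id_lfunE.
have inclK H' (V : {vspace H'}) x : adj (incl V) (incl V x) = x.
  by rewrite -comp_lfunE adj_inclK id_lfunE.
pose u := (adj M \o N)%VF + (incl (lker M) \o f \o adj (incl (lker N)))%VF.
have uE x : u x = adj M (N x) + incl (lker M) (f (adj (incl (lker N)) x)).
  by rewrite add_lfunE !comp_lfunE.
have auE x : adj u x = adj N (M x) + incl (lker N) (adj f (adj (incl (lker M)) x)).
  by rewrite adjD !adj_comp !adjK add_lfunE !comp_lfunE.
exists u; last first.
  by apply/lfunP => x; rewrite comp_lfunE uE linearD /= coisometryK //
    lker_incl addr0.
split; apply/lfunP => x; rewrite comp_lfunE id_lfunE uE auE.
  rewrite !linearD /= coisometryK // lker_incl adj_lker_incl inclK !linear0 add0r.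
  by rewrite addr0 ff' coisometry_decomp.
rewrite !linearD /= coisometryK // lker_incl adj_lker_incl inclK !linear0 add0r.
by rewrite addr0 ff coisometry_decomp.
Qed.

Lemma unitaryK H K (f : 'Hom(H, K)) x : unitary f -> adj f (f x) = x.
Proof. by case=> fK _; rewrite -comp_lfunE fK id_lfunE. Qed.

Lemma unitary_adj H K (f : 'Hom(H, K)) : unitary f -> unitary (adj f).
Proof. by case=> f1 f2; rewrite /unitary adjK. Qed.

(** With [y = adj W x], the two quadratic forms at [x] are the squared norms of
    [m (g y)] and of [g y], and [m] does not increase norms. *)
Lemma op_le_pullback H K L (M : hilb C) (G : 'Hom(K, L)) (W : 'Hom(H, K))
    (m : 'Hom(M, L)) (g : 'Hom(H, M)) :
  coisometry W -> coisometry m -> (G \o W)%VF = (m \o g)%VF ->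
  op_le (adj G \o G)%VF (W \o (adj g \o g) \o adj W)%VF.
Proof.
move=> cW cm GW x; set y := adj W x.
have Gx : G x = m (g y) by rewrite -comp_lfunE -GW comp_lfunE coisometryK.
rewrite add_lfunE opp_lfunE linearBl /= !comp_lfunE subr_ge0 -/y.
rewrite (adjP W) -/y !adj_dot Gx.
exact: coisometry_contract.
Qed.

End HilbertSpaces.

(** * Products in a subproduct system *)

Section SubproductSystems.
Variable C : numClosedFieldType.

Lemma hcast_id (X : nat * nat -> hilb C) s (e : s = s) : hcast X e = \1%VF.
Proof. by rewrite (eq_irrelevance e erefl). Qed.

Section GradedProduct.
Variables (X : nat * nat -> hilb C) (SX : subproduct X).
Implicit Types s t r d : nat * nat.

(** The product with values in any degree [r] provably equal to [s + t]:
    equations between iterated products, whose degrees are equal only up to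
    the laws of addition, can then be stated without transports.  It is locked
    so that rewriting with [comp_lfunE] does not expose the transport. *)
Definition gmul s t r (e : s + t = r) : 'Hom(tens (X s) (X t), X r) :=
  locked (hcast X e \o smul SX s t)%VF.

Lemma gmulE s t r (e : s + t = r) x : gmul e x = hcast X e (smul SX s t x).
Proof. by rewrite /gmul -lock comp_lfunE. Qed.

Lemma gmul_erefl s t : gmul (erefl (s + t)) = smul SX s t.
Proof. by apply/lfunP => x; rewrite gmulE; apply: id_lfunE. Qed.

Lemma coisometry_gmul s t r (e : s + t = r) : coisometry (gmul e).
Proof. by case: _ / e; rewrite gmul_erefl; apply: smul_coisometry. Qed.

Lemma gmulA s t r (a b c : nat * nat) (est : s + t = a) (ea : a + r = c)
    (etr : t + r = b) (eb : s + b = c) x y z :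
  gmul ea (pure (gmul est (pure x y)) z) = gmul eb (pure x (gmul etr (pure y z))).
Proof.
case: _ / est in ea *; case: _ / etr in eb *; case: _ / ea in eb *.
rewrite !gmul_erefl.
have /lfunP/(_ (pure (pure x y) z)) := smulA SX s t r.
rewrite !comp_lfunE assocE !tmapE !id_lfunE => ->.
by rewrite gmulE (eq_irrelevance eb (addrA s t r)).
Qed.

Lemma gmul_vacl s (e : 0 + s = s) x : gmul e (pure (vac SX) x) = x.
Proof. by rewrite gmulE (eq_irrelevance e (add0r s)) smul_vacl. Qed.

Lemma gmul_vacr s (e : s + 0 = s) x : gmul e (pure x (vac SX)) = x.
Proof. by rewrite gmulE (eq_irrelevance e (addr0 s)) smul_vacr. Qed.

(** Since [r] is only provably equal to [s], the common value [x] of the two sides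
    does not live in [X r] and cannot be written there. *)
Lemma gmul_vacC s r (e : 0 + s = r) (e' : s + 0 = r) x :
  gmul e (pure (vac SX) x) = gmul e' (pure x (vac SX)).
Proof.
have er : r = s by rewrite -e add0r.
by case: _ / (esym er) in e e' *; rewrite gmul_vacl gmul_vacr.
Qed.

(** The identification of the scalars with [X 0], as in the empty tensor power. *)
Definition svac : 'Hom(scal C, X 0) := linfun (fun a : scal C => a *: vac SX).

Lemma svacE a : svac a = a *: vac SX.
Proof. by rewrite /svac lfun_linear // => b u v; rewrite scalerDl scalerA. Qed.

Lemma vac_expand (x : X 0) : x = '[x, vac SX] *: vac SX.
Proof.
have vac0 : vac SX != 0 by rewrite -(dnorm_eq0 (hdot (X 0))) dot_vac oner_eq0.
have: x \in <[vac SX]>%VS.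
  apply: subvP (memvf x); rewrite -(geq_leqif (dimv_leqif_sup (subvf _))).
  rewrite (dim_X0 SX); have dimv := dim_vline (K := C) (vac SX).
  by rewrite vac0 in dimv; rewrite dimv.
by case/vlineP=> k ->; rewrite linearZl_LR /= dot_vac mulr1.
Qed.

(** Surjectivity is where the one-dimensionality of [X 0] enters, through
    [vac_expand]. *)
Lemma coisometry_svac : coisometry svac.
Proof.
apply/lfunP => x; rewrite comp_lfunE id_lfunE svacE [RHS]vac_expand; congr (_ *: _).
have := adjP svac (1 : scal C) x; rewrite svacE scale1r dotC.
move=> /(congr1 (fun z => z^*)).
by rewrite conjCK => ->; rewrite [X in X^*]mul1r conjCK.
Qed.

Fixpoint gpow d n : 'Hom(tpow (X d) n, X (d *+ n)) :=
  if n is n'.+1 then (gmul (esym (mulrS d n')) \o tmap \1 (gpow d n'))%VF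
  else svac.

Lemma gpowS d n x (t : tpow (X d) n) :
  gpow d n.+1 (pure x t) = gmul (esym (mulrS d n)) (pure x (gpow d n t)).
Proof. by rewrite [LHS]comp_lfunE tmapE id_lfunE. Qed.

Lemma coisometry_gpow d n : coisometry (gpow d n).
Proof.
elim: n => [|n IHn]; first exact: coisometry_svac.
apply: coisometry_comp (coisometry_gmul _) _.
exact: coisometry_tmap (coisometry1 _) IHn.
Qed.

Lemma tpow_catSE d m n x a b :
  tpow_cat (X d) m.+1 n (pure (pure x a) b) = pure x (tpow_cat (X d) m n (pure a b)).
Proof. by rewrite tpow_catS comp_lfunE assocE tmapE id_lfunE. Qed.

Lemma gpow_cat d m n (e : d *+ m + d *+ n = d *+ (m + n)) a b :
  gpow d (m + n) (tpow_cat (X d) m n (pure a b)) =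
  gmul e (pure (gpow d m a) (gpow d n b)).
Proof.
elim: m => [|m IHm] in e a *.
  rewrite [tpow_cat _ _ _ _]lunitE [gpow d 0 a]svacE pureZl !linearZ /=.
  by rewrite gmul_vacl.
elim/tens_ind: a => [x a|k a a' IHa IHa']; last first.
  by rewrite pure_linearl !linearP /= pure_linearl linearP /= IHa IHa'.
rewrite tpow_catSE [LHS]gpowS (IHm (esym (mulrnDr d m n))) gpowS.
by rewrite [RHS](gmulA _ _ (esym (mulrnDr d m n)) (esym (mulrS d (m + n)))).
Qed.

(** If exchanging two letters by [u] does not change their product, then neither
    does exchanging two blocks of letters by [twist1 u] or [twist u]. *)
Section TwistedProduct.
Variables (d d' : nat * nat) (u : 'Hom(tens (X d') (X d), tens (X d) (X d'))).
Hypothesis ucomm : forall r (e : d + d' = r) (e' : d' + d = r)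
  (t : tens (X d') (X d)), gmul e (u t) = gmul e' t.

Lemma gmul_twist1 n r (e : d *+ n + d' = r) (e' : d' + d *+ n = r)
    (t : tens (X d') (tpow (X d) n)) :
  gmul e (tmap (gpow d n) \1 (twist1 u n t)) = gmul e' (tmap \1 (gpow d n) t).
Proof.
elim: n => [|n IHn] in r e e' t *.
  elim/tens_ind: t => [f c|k v v' IHv IHv']; last by rewrite !linearP /= IHv IHv'.
  rewrite [twist1 _ _ _]comp_lfunE runitE lunitVE !tmapE !id_lfunE.
  rewrite ![gpow d 0 _]svacE scale1r !pureZr !linearZ /=.
  by congr (_ *: _); apply: gmul_vacC.
elim/tens_ind_assocV: t => [f x a|k v v' IHv IHv']; last first.
  by rewrite !linearP /= IHv IHv'.
rewrite twist1S !comp_lfunE assocVE !tmapE !id_lfunE gpowS.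
have edd : d + d' = d' + d by rewrite addrC.
have er : d' + d + d *+ n = r by rewrite -addrA -mulrS.
(* f (x a) = (f x) a, and u may replace f x by a sum of products x' f'. *)
rewrite -(gmulA (erefl (d' + d)) er) -(ucomm edd (erefl _)).
move: (u _) => w; elim/tens_ind: w => [x' f'|k v v' IHv IHv']; last first.
  by rewrite pure_linearl !linearP /= IHv IHv' pure_linearl linearP.
have eb : d + (d' + d *+ n) = r by rewrite -er addrA edd.
(* (x' f') a = x' (f' a), and the induction hypothesis applies to f' a. *)
rewrite assocE tmapE id_lfunE (gmulA edd er (erefl (d' + d *+ n)) eb).
have := IHn _ (addrC (d *+ n) d') (erefl _) (pure f' a).
rewrite tmapE id_lfunE => <-.
move: (twist1 _ _ _) => w; elim/tens_ind: w => [b g|k v v' IHv IHv']; last first.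
  by rewrite pure_linearr !linearP /= IHv IHv' pure_linearr linearP.
rewrite assocVE !tmapE !id_lfunE gpowS.
exact: gmulA.
Qed.

Lemma gmul_twist m n r (e : d *+ n + d' *+ m = r) (e' : d' *+ m + d *+ n = r)
    (t : tens (tpow (X d') m) (tpow (X d) n)) :
  gmul e (tmap (gpow d n) (gpow d' m) (twist u m n t)) =
  gmul e' (tmap (gpow d' m) (gpow d n) t).
Proof.
elim: m => [|m IHm] in r e e' t *.
  elim/tens_ind: t => [c a|k v v' IHv IHv']; last by rewrite !linearP /= IHv IHv'.
  rewrite [twist _ _ _ _]comp_lfunE lunitE runitVE !tmapE.
  rewrite ![gpow d' 0 _]svacE scale1r linearZ !pureZl !linearZ /=.
  by congr (_ *: _); apply/esym/gmul_vacC.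
elim/tens_ind_assoc: t => [f a b|k v v' IHv IHv']; last first.
  by rewrite !linearP /= IHv IHv'.
rewrite twistS !comp_lfunE assocE !tmapE !id_lfunE gpowS.
have er : d' + (d' *+ m + d *+ n) = r by rewrite addrA -mulrS.
(* (f a) b = f (a b), and the induction hypothesis moves a past b. *)
rewrite (gmulA _ _ (erefl _) er) -tmapE -(IHm _ (addrC _ _)).
move: (twist _ _ _ _) => w; elim/tens_ind: w => [b' a'|k v v' IHv IHv']; last first.
  by rewrite pure_linearr !linearP /= IHv IHv' pure_linearr linearP.
have ea' : (d' + d *+ n) + d' *+ m = r by rewrite (addrC d') -addrA -mulrS.
(* f (b' a') = (f b') a', and the single letter f moves past b'. *)
rewrite assocVE !tmapE !id_lfunE -(gmulA (erefl _) ea').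
have := @gmul_twist1 n _ (addrC _ _) (erefl (d' + d *+ n)) (pure f b').
rewrite tmapE id_lfunE => <-.
move: (twist1 _ _ _) => w; elim/tens_ind: w => [b'' g|k v v' IHv IHv']; last first.
  by rewrite pure_linearl !linearP /= IHv IHv' pure_linearl linearP.
rewrite assocE !tmapE !id_lfunE gpowS.
exact/esym/gmulA.
Qed.

End TwistedProduct.
End GradedProduct.
End SubproductSystems.

(** * Transport of a subproduct system along unitaries *)

Section Transport.
Variables (C : numClosedFieldType) (X Y : nat * nat -> hilb C).
Variables (SX : subproduct X) (V : forall s, 'Hom(X s, Y s)).
Hypothesis unitV : forall s, unitary (V s).

Lemma hcast_natural s t (e : s = t) x : hcast Y e (V s x) = V t (hcast X e x).
Proof. by case: _ / e; rewrite !hcast_id !id_lfunE. Qed.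

Definition transport_smul s t : 'Hom(tens (Y s) (Y t), Y (s + t)) :=
  (V (s + t) \o smul SX s t \o tmap (adj (V s)) (adj (V t)))%VF.

Lemma transport_smulE s t x y : transport_smul s t (pure x y) =
  V (s + t) (smul SX s t (pure (adj (V s) x) (adj (V t) y))).
Proof. by rewrite !comp_lfunE tmapE. Qed.

Lemma transport_dim : \dim {:Y 0} = 1%N.
Proof.
have [f1 f2] := unitV 0.
have k0 : lker (V 0) = 0%VS.
  by apply/eqP/lker0P => x y /(congr1 (adj (V 0))); rewrite !unitaryK.
have := limg_ker_dim (V 0) fullv.
by rewrite capfv k0 dimv0 coisometry_limg // (dim_X0 SX).
Qed.

Lemma transport_dot_vac : '[V 0 (vac SX), V 0 (vac SX)] = 1.
Proof. by rewrite adjP unitaryK // dot_vac. Qed.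

Lemma transport_coisometry s t : coisometry (transport_smul s t).
Proof.
have cV r : coisometry (adj (V r)) by case: (unitary_adj (unitV r)).
apply: coisometry_comp (coisometry_tmap (cV s) (cV t)).
by apply: coisometry_comp (smul_coisometry SX s t); case: (unitV (s + t)).
Qed.

Lemma transport_vacr s (x : Y s) :
  hcast Y (addr0 s) (transport_smul s 0 (pure x (V 0 (vac SX)))) = x.
Proof.
rewrite transport_smulE hcast_natural unitaryK // smul_vacr.
by rewrite coisometryK //; case: (unitV s).
Qed.

Lemma transport_vacl s (x : Y s) :
  hcast Y (add0r s) (transport_smul 0 s (pure (V 0 (vac SX)) x)) = x.
Proof.
rewrite transport_smulE hcast_natural unitaryK // smul_vacl.
by rewrite coisometryK //; case: (unitV s).
Qed.

Lemma transport_smulA s t r :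
  (transport_smul (s + t) r \o tmap (transport_smul s t) \1)%VF =
  (hcast Y (addrA s t r) \o transport_smul s (t + r)
     \o tmap \1 (transport_smul t r) \o assoc (Y s) (Y t) (Y r))%VF.
Proof.
apply/lfunP => w; elim/tens_ind_assoc: w => [x y z|a v w Hv Hw]; last first.
  by rewrite !linearP /= Hv Hw.
rewrite comp_lfunE tmapE id_lfunE !transport_smulE unitaryK //.
rewrite 3!comp_lfunE assocE tmapE id_lfunE !transport_smulE unitaryK //.
rewrite hcast_natural; congr (V _ _).
have /lfunP/(_ (pure (pure (adj (V s) x) (adj (V t) y)) (adj (V r) z))) :=
  smulA SX s t r.
by rewrite !comp_lfunE assocE !tmapE !id_lfunE.
Qed.

Definition transport : subproduct Y :=
  Subproduct transport_dim transport_dot_vac transport_coisometry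
    transport_vacr transport_vacl transport_smulA.

Lemma transport_isomorphic : isomorphic SX transport.
Proof.
left; exists V; split=> // s t _ _.
apply: tens_ext => x y.
rewrite [RHS]comp_lfunE tmapE [RHS]transport_smulE !unitaryK //.
by rewrite comp_lfunE [LHS]comp_lfunE; apply: id_lfunE.
Qed.

End Transport.

(** * The model inside the tensor powers of E and F *)

Section Model.
Variables (C : numClosedFieldType) (X : nat * nat -> hilb C) (SX : subproduct X).
Implicit Types s t : nat * nat.

Let degE : nat * nat := (1, 0)%N.
Let degF : nat * nat := (0, 1)%N.
Let E := X degE.
Let F := X degF.

Lemma EF_degree s : degE *+ s.1 + degF *+ s.2 = s.
Proof.
have muln2 (a : nat * nat) n : a *+ n = (a.1 * n, a.2 * n)%N.
  by elim: n => [|n IHn]; rewrite ?mulrS ?IHn ?muln0 // !mulnS.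
by case: s => m n; rewrite !muln2 /= !mul1n !mul0n; congr pair; exact: addn0.
Qed.

Definition wordmul s : 'Hom(EF E F s, X s) :=
  (gmul SX (EF_degree s) \o tmap (gpow SX degE s.1) (gpow SX degF s.2))%VF.

Lemma wordmul_pure s a b :
  wordmul s (pure a b) =
    gmul SX (EF_degree s) (pure (gpow SX degE s.1 a) (gpow SX degF s.2 b)).
Proof. by rewrite comp_lfunE tmapE. Qed.

Lemma coisometry_wordmul s : coisometry (wordmul s).
Proof.
apply: coisometry_comp; first exact: coisometry_gmul.
by apply: coisometry_tmap; apply: coisometry_gpow.
Qed.

(** In degree (1, 1) the two letters come with a scalar 1 from the empty tail of
    each tensor power; it contributes a factor [vac SX]. *)
Lemma wordmul_EF11 :
  (wordmul (1, 1)%N \o EF11 E F)%VF = smul SX degE degF.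
Proof.
apply: tens_ext => x y.
rewrite comp_lfunE tmapE !runitVE wordmul_pure !gpowS.
have gpow0 d : gpow SX d 0 1 = vac SX by rewrite [LHS]svacE scale1r.
rewrite !gpow0 !gmul_vacr.
by rewrite (eq_irrelevance (EF_degree _) erefl) gmul_erefl.
Qed.

(** Concatenating two words and sorting the letters with [u] multiplies their
    values: with values [a b] and [c d], both sides are [a (b c) d], and
    [twist u] does not change the product [b c]. *)
Lemma wordmul_W (u : 'Hom(tens F E, tens E F)) s t :
  (smul SX degE degF \o u)%VF = smul SX degF degE ->
  (wordmul (s + t) \o W u s t)%VF = (smul SX s t \o tmap (wordmul s) (wordmul t))%VF.
Proof.
move=> ucomm.
have {}ucomm r (e : degE + degF = r) (e' : degF + degE = r) w :
    gmul SX e (u w) = gmul SX e' w.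
  case: _ / e in e' *; rewrite gmul_erefl -comp_lfunE ucomm.
  by rewrite -(gmul_erefl SX degF degE); congr (gmul _ _ _); apply: eq_irrelevance.
apply/lfunP; apply: tens_ind => [v w|k v w Hv Hw]; last by rewrite !linearP /= Hv Hw.
elim/tens_ind: v => [a b|k v v' Hv Hv']; last first.
  by rewrite pure_linearl !linearP /= Hv Hv'.
elim/tens_ind: w => [c d|k w w' Hw Hw']; last first.
  by rewrite pure_linearr !linearP /= Hw Hw'.
rewrite WE !comp_lfunE assocE !tmapE !id_lfunE !comp_lfunE assocVE !tmapE !id_lfunE.
pose A := degE *+ s.1; pose B := degF *+ s.2.
pose C' := degE *+ t.1; pose D := degF *+ t.2.
have Es : A + B = s := EF_degree s; have Et : C' + D = t := EF_degree t.
have eb : A + (B + t) = s + t by rewrite addrA Es.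
have ec : B + C' + D = B + t by rewrite -addrA Et.
(* The right-hand side (a b) (c d) becomes a ((b c) d). *)
rewrite -gmul_erefl (gmulA SX _ _ (erefl (B + t)) eb).
rewrite -(gmulA SX (erefl (B + C')) ec).
have := gmul_twist ucomm (m := s.2) (n := t.1) (addrC _ _) (erefl _) (pure b c).
rewrite [X in _ = gmul _ _ X -> _]tmapE => <-.
move: (twist _ _ _ _) => w; elim/tens_ind: w => [c' b'|k w w' Hw Hw']; last first.
  rewrite pure_linearl !linearP /= pure_linearr !linearP /= Hw Hw'.
  by rewrite pure_linearl !linearP /= pure_linearr linearP.
rewrite assocE assocVE !tmapE.
rewrite (gpow_cat SX (esym (mulrnDr degE s.1 t.1))).
rewrite (gpow_cat SX (esym (mulrnDr degF s.2 t.2))).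
have er : C' + degF *+ (s.2 + t.2) = B + t.
  by rewrite mulrnDr addrCA Et.
rewrite (gmulA SX _ _ er eb); congr (gmul _ _ (pure _ _)).
exact/esym/gmulA.
Qed.

Definition model s : {vspace EF E F s} := limg (adj (wordmul s)).

(** [adj (wordmul s)] with its target restricted to its range. *)
Definition model_map s : 'Hom(X s, hsub (model s)) :=
  (adj (incl (model s)) \o adj (wordmul s))%VF.

Lemma orthproj_model s : orthproj (model s) = (adj (wordmul s) \o wordmul s)%VF.
Proof. exact/orthproj_limg/coisometry_wordmul. Qed.

Lemma adj_model_map s : adj (model_map s) = (wordmul s \o incl (model s))%VF.
Proof. by rewrite adj_comp !adjK. Qed.

Lemma incl_model_map s : (incl (model s) \o model_map s)%VF = adj (wordmul s).
Proof.
rewrite comp_lfunA -orthproj_incl orthproj_model -comp_lfunA.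
by have := coisometry_wordmul s; rewrite /coisometry => ->; rewrite comp_lfun1r.
Qed.

Lemma unitary_model_map s : unitary (model_map s).
Proof.
rewrite /unitary adj_model_map; split.
  by rewrite -comp_lfunA incl_model_map; apply: coisometry_wordmul.
rewrite comp_lfunA -(comp_lfunA (adj (incl _))) -orthproj_model orthproj_incl.
by rewrite comp_lfunA adj_inclK comp_lfun1l adj_inclK.
Qed.

Definition model_subproduct : subproduct (fun s => hsub (model s)) :=
  transport SX unitary_model_map.

(** Both sides of the first equation are images under the isometry
    [adj (wordmul (1, 1))] of the two sides of the second. *)
Lemma admissibleP (u : 'Hom(tens F E, tens E F)) :
  (orthproj (model (1, 1)%N) \o EF11 E F \o u)%VF =
      (EF11 E F \o adj (smul SX degE degF) \o smul SX degF degE)%VF <->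
  (smul SX degE degF \o u)%VF = smul SX degF degE.
Proof.
have EF11_adj : (EF11 E F \o adj (smul SX degE degF))%VF = adj (wordmul (1, 1)%N).
  have cEF : coisometry (EF11 E F).
    by apply: coisometry_tmap; apply: coisometry_runitV.
  by rewrite -wordmul_EF11 adj_comp comp_lfunA cEF comp_lfun1l.
rewrite EF11_adj orthproj_model -(comp_lfunA (adj _) (wordmul _) (EF11 E F)).
rewrite wordmul_EF11 -(comp_lfunA _ _ u); split=> [Mu|-> //]; apply/lfunP => x.
have /lfunP/(_ x)/(congr1 (wordmul (1, 1)%N)) := Mu.
rewrite (comp_lfunE (adj _) (smul SX degE degF \o u)) (comp_lfunE (adj _)).
by rewrite !coisometryK //; apply: coisometry_wordmul.
Qed.

Lemma admissible_exists : exists2 u : 'Hom(tens F E, tens E F),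
  unitary u & (smul SX degE degF \o u)%VF = smul SX degF degE.
Proof.
apply: unitary_lift; [exact: smul_coisometry|exact: (smul_coisometry SX degF degE)|].
by rewrite !dim_tens mulnC.
Qed.

Section Admissible.
Variable u : 'Hom(tens F E, tens E F).
Hypothesis (unitu : unitary u).
Hypothesis (Mu : (smul SX degE degF \o u)%VF = smul SX degF degE).

Lemma model_smulE s t :
  (incl (model (s + t)) \o smul model_subproduct s t)%VF =
  (orthproj (model (s + t)) \o W u s t \o tmap (incl (model s)) (incl (model t)))%VF.
Proof.
rewrite orthproj_model -[in RHS]comp_lfunA -[in RHS]comp_lfunA.
rewrite (comp_lfunA (wordmul _)) wordmul_W //.
rewrite -[smul model_subproduct s t]/(transport_smul SX model_map s t).
rewrite /transport_smul.
rewrite 2!(comp_lfunA (incl _)) incl_model_map !adj_model_map tmap_comp.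
by rewrite !comp_lfunA.
Qed.

Lemma model_le_left s t :
  op_le (orthproj (model (s + t)))
    (W u s t \o tmap (orthproj (model s)) \1 \o adj (W u s t))%VF.
Proof.
have -> : tmap (orthproj (model s)) (\1 : 'End(EF E F t)) =
    (adj (tmap (wordmul s) \1) \o tmap (wordmul s) \1)%VF.
  by rewrite adj_tmap adj_id -tmap_comp comp_lfun1l orthproj_model.
rewrite orthproj_model.
apply: (op_le_pullback (m := (smul SX s t \o tmap \1 (wordmul t))%VF)).
- by apply: coisometry_W; case: unitu.
- apply: coisometry_comp (smul_coisometry SX s t) _.
  exact: coisometry_tmap (coisometry1 _) (coisometry_wordmul t).
by rewrite wordmul_W // -comp_lfunA -tmap_comp comp_lfun1l comp_lfun1r.
Qed.

Lemma model_le_right s t :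
  op_le (orthproj (model (s + t)))
    (W u s t \o tmap \1 (orthproj (model t)) \o adj (W u s t))%VF.
Proof.
have -> : tmap (\1 : 'End(EF E F s)) (orthproj (model t)) =
    (adj (tmap \1 (wordmul t)) \o tmap \1 (wordmul t))%VF.
  by rewrite adj_tmap adj_id -tmap_comp comp_lfun1l orthproj_model.
rewrite orthproj_model.
apply: (op_le_pullback (m := (smul SX s t \o tmap (wordmul s) \1)%VF)).
- by apply: coisometry_W; case: unitu.
- apply: coisometry_comp (smul_coisometry SX s t) _.
  exact: coisometry_tmap (coisometry_wordmul s) (coisometry1 _).
by rewrite wordmul_W // -comp_lfunA -tmap_comp comp_lfun1l comp_lfun1r.
Qed.

End Admissible.
End Model.

Theorem proposition3p1 (R : realType) (X : nat * nat -> hilb R[i])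
    (SX : subproduct X) :
  let E := X (1, 0)%N in
  let F := X (0, 1)%N in
  exists (Y : forall s : nat * nat, {vspace EF E F s})
         (SY : subproduct (fun s => hsub (Y s))),
    let p (s : nat * nat) : 'End(EF E F s) := orthproj (Y s) in
    let admissible (u : 'Hom(tens F E, tens E F)) : Prop :=
      unitary u /\
      (p (1, 1)%N \o EF11 E F \o u)%VF =
      (EF11 E F \o adj (smul SX (1, 0)%N (0, 1)%N)
        \o smul SX (0, 1)%N (1, 0)%N)%VF in
    isomorphic SX SY /\
    (exists u, admissible u) /\
    forall u, admissible u ->
      (forall s t : nat * nat,
         (incl (Y (s + t)) \o smul SY s t)%VF =
         (p (s + t) \o W u s t \o tmap (incl (Y s)) (incl (Y t)))%VF) /\
      (forall s t : nat * nat,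
         op_le (p (s + t))
           (W u s t \o tmap (p s) \1 \o adj (W u s t))%VF) /\
      (forall s t : nat * nat,
         op_le (p (s + t))
           (W u s t \o tmap \1 (p t) \o adj (W u s t))%VF).
Proof.
move=> E F; exists (model SX), (model_subproduct SX) => p admissible.
split; first exact: transport_isomorphic.
split.
  have [u unitu Mu] := admissible_exists SX.
  by exists u; split=> //; apply/admissibleP.
move=> u [unitu /admissibleP Mu]; split; first exact: model_smulE.
by split; [apply: model_le_left | apply: model_le_right].
Qed.
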